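(* Let $f\colon M^n(0)\to\mathbb{R}^{2n}$ be a Lagrangian isometric immersion of a flat Riemannian manifold such that $f(M^n(0))\subset\mathbb{S}^{2n-1}$. If $\tilde f=\mathcal{R}_{\varphi,\beta,\Omega,P}(f)\colon\tilde M^n(0)\to\mathbb{R}^{2n}$ is a $P^*$-transform of $f$, then $\tilde f(\tilde M^n(0))\subset\mathbb{S}^{2n-1}$.
   Context: $\mathbb{S}^{2n-1}$ is the unit sphere in $\mathbb{R}^{2n}\cong\mathbb{C}^n$, and $J$ is the complex structure. An isometric immersion $f\colon M^n\to\mathbb{C}^n$ is Lagrangian if $J$ carries each tangent space of $M^n$ onto the corresponding normal space. $N_fM$, $\nabla^\perp$, $\alpha$, $A_\xi$ denote the normal bundle, normal connection, second fundamental form and shape operators of $f$. The superscript $t$ denotes transpose. Vectorial Ribaucour transform. Let $V$ be a (finite-dimensional) Euclidean vector space, identified with the trivial bundle $M\times V$ with its flat connection; $V^*\otimes V$ is identified with the endomorphisms of $V$. Let $\varphi\colon M\to V$ be smooth, $\omega=d\varphi$, $\langle\omega^t(v),X\rangle=\langle v,\omega(X)\rangle$, and let $\beta\in\Gamma(V^*\otimes N_fM)$ satisfy $\alpha(X,\omega^t(v))+(\nabla_X\beta)v=0$ (with $(\nabla_X\beta)v=\nabla^\perp_X(\beta(v))-\beta(\nabla_Xv)$) and $[\Phi_u,\Phi_v]=0$ for all $X,u,v$, where $\Phi_vX=\Phi(X)(v)=(\nabla_X\omega^t)v-A_{\beta(v)}X$. Put $\mathcal{F}=f_*\omega^t+\beta$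 and let $\Omega\in\Gamma(V^*\otimes V)$ be everywhere invertible with $d\Omega=\mathcal{F}^td\mathcal{F}$ and $\Omega+\Omega^t=\mathcal{F}^t\mathcal{F}$. Then $\tilde f=\mathcal{R}_{\varphi,\beta,\Omega}(f)=f-\mathcal{F}\Omega^{-1}\varphi$, defined on the set $\tilde M^n$ of its regular points with the induced metric, is the vectorial Ribaucour transform of $f$ determined by $(\varphi,\beta,\Omega)$. $P$-transform. For $f$ Lagrangian with flat $M^n(0)$, $\tilde f=\mathcal{R}_{\varphi,\beta,\Omega}(f)$ is a $P$-transform of $f$, written $\mathcal{R}_{\varphi,\beta,\Omega,P}(f)$, if there is $P\in V^*\otimes V$ with $\sigma(P)\cap(-\sigma(P))=\emptyset$ ($\sigma(P)$ the set of complex eigenvalues of $P$) such that $\beta=Jf_*\omega^tP$ and $\Omega^tP+P^t\Omega^t+T\rho=0$, where $T=-P^t-(P^t)^{-1}$ and $\rho=P^t\omega\omega^tP$. Principal coordinates. A Lagrangian isometric immersion $f\colon M^n(0)\to\mathbb{R}^{2n}$ with zero index of relative nullity (automatic if $f(M)\subset\mathbb{S}^{2n-1}$) admits locally principal coordinates $u_1,\ldots,u_n$ and positive functions $v_1,\ldots,v_n$ with $ds^2=\sum_jv_j^2du_j^2$ and $\alpha(\partial_i,\partial_j)=\delta_{ij}Jf_*\partial_i$, $\partial_i=\partial/\partial u_i$. $P^*$-transform. If $f(M^n(0))\subset\mathbb{S}^{2n-1}$, a $P$-transform $\mathcal{R}_{\varphi,\beta,\Omega,P}(f)$ of $f$ (on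 an open set endowed with such coordinates) is a $P^*$-transform if $\varphi+\sum_{i=1}^nv_iP^t\gamma_i=0$, where $\gamma_i=v_i^{-1}\omega(\partial_i)$. *)

(* Defs.v *)
From HB Require Import structures.
From mathcomp Require Import all_boot all_order all_algebra.
From mathcomp Require Import complex.
From mathcomp Require Import all_classical all_reals all_analysis.

Set Implicit Arguments.
Unset Strict Implicit.
Unset Printing Implicit Defensive.

Import Order.TTheory GRing.Theory Num.Theory.
Import numFieldNormedType.Exports.

Local Open Scope classical_set_scope.
Local Open Scope ring_scope.

Definition dot (R : realType) (m : nat) (u w : 'cV[R]_m) : R :=
  (u^T *m w) 0 0.

Definition unit_sphere (R : realType) (m : nat) : set 'cV[R]_m :=
  [set y | dot y y = 1].
Arguments unit_sphere : clear implicits.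

(* C^n is R^n + i R^n: the column (x, y) stands for x + i y. *)
Definition J (R : realType) (n : nat) : 'M[R]_(n + n) :=
  block_mx 0 (- 1%:M) 1%:M 0.

(* C^infinity on U (used for U open): all iterated directional derivatives
   are differentiable at the points of U. *)
Definition smooth_on (R : realType) (n : nat) (W : normedModType R)
    (U : set 'cV[R]_n) (F : 'cV[R]_n -> W) : Prop :=
  forall (s : seq 'cV[R]_n) (x : 'cV[R]_n), U x ->
    differentiable (foldr (fun (w : 'cV[R]_n) (h : 'cV[R]_n -> W) => 'D_w h) F s) x.

Definition basis_vec (R : realType) (n : nat) (i : 'I_n) : 'cV[R]_n :=
  delta_mx i 0.

Definition jac (R : realType) (n m : nat) (F : 'cV[R]_n -> 'cV[R]_m)
    (x : 'cV[R]_n) : 'M[R]_(m, n) :=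
  \matrix_(a, i) ('D_(basis_vec R i) F x) a 0.

Section LocalGeometry.
(* Local expressions in a coordinate domain U of R^n.  A tangent vector is the
   column of its coordinates, and g x is the Gram matrix of the metric. *)
Variables (R : realType) (n : nat).
Implicit Types (U : set 'cV[R]_n) (g : 'cV[R]_n -> 'M[R]_n) (x X Y : 'cV[R]_n).

Definition ginner g x X Y : R := (X^T *m g x *m Y) 0 0.

Definition riemannian_metric_on U g : Prop :=
  [/\ smooth_on U g,
      forall x, U x -> (g x)^T = g x &
      forall x X, U x -> X != 0 -> 0 < ginner g x X X].

Definition partial_metric g (i j l : 'I_n) x : R :=
  ('D_(basis_vec R i) g x) j l.

Definition christoffel g x (l i j : 'I_n) : R :=
  2^-1 * \sum_(m < n) invmx (g x) l m *
    (partial_metric g i j m x + partial_metric g j i m x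
       - partial_metric g m i j x).

(* Levi-Civita derivative, at x and along X, of the vector field Y. *)
Definition nabla g X (Y : 'cV[R]_n -> 'cV[R]_n) x : 'cV[R]_n :=
  'D_X Y x
    + \col_l \sum_(i < n) \sum_(j < n) christoffel g x l i j * X i 0 * Y x j 0.

(* Vanishing of the curvature tensor R(X, Y)Z; it is enough to test it on
   coordinate-constant fields, for which [X, Y] = 0. *)
Definition flat_on U g : Prop :=
  forall x X Y (Z : 'cV[R]_n), U x ->
    nabla g X (nabla g Y (cst Z)) x - nabla g Y (nabla g X (cst Z)) x = 0.

(* Since g is positive definite, the second clause makes f an immersion. *)
Definition isometric_immersion_on (m : nat) U g (f : 'cV[R]_n -> 'cV[R]_m) :
    Prop :=
  smooth_on U f /\ forall x, U x -> (jac f x)^T *m jac f x = g x.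

Definition normal_vector (m : nat) (f : 'cV[R]_n -> 'cV[R]_m) x
    (xi : 'cV[R]_m) : Prop :=
  forall X, dot (jac f x *m X) xi = 0.

Definition lagrangian_on U (f : 'cV[R]_n -> 'cV[R]_(n + n)) : Prop :=
  forall x, U x -> forall xi,
    normal_vector f x xi <-> exists X, xi = J R n *m (jac f x *m X).

Section SecondFundamentalForm.
Variables (m : nat) (g : 'cV[R]_n -> 'M[R]_n) (f : 'cV[R]_n -> 'cV[R]_m).

(* Gauss formula alpha(X, Y) = D_X (f_* Y) - f_* (nabla_X Y); it is tensorial,
   so Y is extended with constant coordinates. *)
Definition sff x X Y : 'cV[R]_m :=
  'D_X (fun y => jac f y *m Y) x - jac f x *m nabla g X (cst Y) x.

Definition shape x (xi : 'cV[R]_m) : 'M[R]_n :=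
  invmx (g x) *m
    \matrix_(i, j) dot (sff x (basis_vec R i) (basis_vec R j)) xi.

Definition normal_part x (w : 'cV[R]_m) : 'cV[R]_m :=
  w - jac f x *m (invmx (g x) *m (jac f x)^T *m w).

Definition nablaN X (xi : 'cV[R]_n -> 'cV[R]_m) x : 'cV[R]_m :=
  normal_part x ('D_X xi x).

End SecondFundamentalForm.

(* V is R^k with its standard inner product; phi takes values in V, and
   sections of V^* (x) N_f M and V^* (x) V are matrix-valued. *)
Section Ribaucour.
Variables (m k : nat) (g : 'cV[R]_n -> 'M[R]_n) (f : 'cV[R]_n -> 'cV[R]_m).
Variables (phi : 'cV[R]_n -> 'cV[R]_k) (beta : 'cV[R]_n -> 'M[R]_(m, k)).
Variable (Omega : 'cV[R]_n -> 'M[R]_k).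

Definition omega x : 'M[R]_(k, n) := jac phi x.

(* The adjoint of omega with respect to g; see omega_tP. *)
Definition omega_t x : 'M[R]_(n, k) := invmx (g x) *m (omega x)^T.

(* Constant sections v of the flat bundle M x V are parallel and the covariant
   derivatives of beta and omega^t are tensorial in v, so that only
   constant v occur. *)
Definition nabla_beta X (v : 'cV[R]_k) x : 'cV[R]_m :=
  nablaN g f X (fun y => beta y *m v) x.

Definition nabla_omega_t X (v : 'cV[R]_k) x : 'cV[R]_n :=
  nabla g X (fun y => omega_t y *m v) x.

Definition Phi (v : 'cV[R]_k) x X : 'cV[R]_n :=
  nabla_omega_t X v x - shape g f x (beta x *m v) *m X.

Definition calF x : 'M[R]_(m, k) := jac f x *m omega_t x + beta x.

Record ribaucour_data (U : set 'cV[R]_n) : Prop := RibaucourData {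
  ribaucour_smooth_phi : smooth_on U phi;
  ribaucour_smooth_beta : smooth_on U beta;
  ribaucour_smooth_Omega : smooth_on U Omega;
  ribaucour_beta_normal : forall x v, U x -> normal_vector f x (beta x *m v);
  ribaucour_codazzi : forall x X v, U x ->
    sff g f x X (omega_t x *m v) + nabla_beta X v x = 0;
  ribaucour_commute : forall x u v X, U x ->
    Phi u x (Phi v x X) - Phi v x (Phi u x X) = 0;
  ribaucour_Omega_unit : forall x, U x -> Omega x \in unitmx;
  ribaucour_dOmega : forall x X, U x ->
    'D_X Omega x = (calF x)^T *m 'D_X calF x;
  ribaucour_Omega_sym : forall x, U x ->
    Omega x + (Omega x)^T = (calF x)^T *m calF x }.

Definition ribaucour x : 'cV[R]_m :=
  f x - calF x *m invmx (Omega x) *m phi x.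

End Ribaucour.

Definition regular_points (m : nat) U (h : 'cV[R]_n -> 'cV[R]_m) :
    set 'cV[R]_n :=
  [set x | U x /\ forall X, jac h x *m X = 0 -> X = 0].

Definition spectrum (k : nat) (P : 'M[R]_k) : set R[i] :=
  [set a | eigenvalue (map_mx (real_complex R) P) a].

Section PTransform.
Variables (k : nat) (U : set 'cV[R]_n) (g : 'cV[R]_n -> 'M[R]_n).
Variable (f : 'cV[R]_n -> 'cV[R]_(n + n)).
Variables (phi : 'cV[R]_n -> 'cV[R]_k) (beta : 'cV[R]_n -> 'M[R]_(n + n, k)).
Variables (Omega : 'cV[R]_n -> 'M[R]_k) (P : 'M[R]_k).

(* P is invertible because 0 is not in sigma(P) by P_spectrum. *)
Definition opT : 'M[R]_k := - P^T - invmx P^T.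

Definition rho x : 'M[R]_k := P^T *m omega phi x *m omega_t g phi x *m P.

Record P_transform_data : Prop := PTransformData {
  P_ribaucour : ribaucour_data g f phi beta Omega U;
  P_spectrum :
    spectrum P `&` [set - a | a in spectrum P] = set0;
  P_beta : forall x, U x ->
    beta x = J R n *m jac f x *m omega_t g phi x *m P;
  P_Omega : forall x, U x ->
    (Omega x)^T *m P + P^T *m (Omega x)^T + opT *m rho x = 0 }.

(* The standard coordinates of U play the role of u_1, ..., u_n, so that
   f_* (d / d u_i) is jac f x *m basis_vec R i. *)
Record principal_coordinates (v : 'I_n -> 'cV[R]_n -> R) : Prop :=
  PrincipalCoordinates {
    principal_pos : forall i x, U x -> 0 < v i x;
    principal_metric : forall x (i j : 'I_n), U x ->
      g x i j = if i == j then v i x ^+ 2 else 0;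
    principal_sff : forall x (i j : 'I_n), U x ->
      sff g f x (basis_vec R i) (basis_vec R j) =
        if i == j then J R n *m (jac f x *m basis_vec R i) else 0 }.

Definition gamma (v : 'I_n -> 'cV[R]_n -> R) (i : 'I_n) x : 'cV[R]_k :=
  (v i x)^-1 *: (omega phi x *m basis_vec R i).

Record Pstar_transform_data (v : 'I_n -> 'cV[R]_n -> R) : Prop :=
  PstarTransformData {
    Pstar_principal : principal_coordinates v;
    Pstar_P : P_transform_data;
    Pstar_eq : forall x, U x ->
      phi x + \sum_(i < n) v i x *: (P^T *m gamma v i x) = 0 }.

End PTransform.

Lemma omega_tP (k : nat) g (phi : 'cV[R]_n -> 'cV[R]_k) x (v : 'cV[R]_k) X :
  g x \in unitmx -> (g x)^T = g x ->
  ginner g x (omega_t g phi x *m v) X = dot v (omega phi x *m X).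
Proof.
move=> gu gs; rewrite /ginner /dot /omega_t !trmx_mul trmxK trmx_inv gs.
by rewrite !mulmxA mulmxKV.
Qed.

End LocalGeometry.

Section Manifolds.
Variables (R : realType) (M : topologicalType) (n : nat).

Record chart : Type := Chart {
  chart_dom : set M;
  chart_img : set 'cV[R]_n;
  chart_to : M -> 'cV[R]_n;
  chart_inv : 'cV[R]_n -> M;
  chart_dom_open : open chart_dom;
  chart_img_open : open chart_img;
  chart_to_img : forall p, chart_dom p -> chart_img (chart_to p);
  chart_inv_dom : forall x, chart_img x -> chart_dom (chart_inv x);
  chart_toK : forall p, chart_dom p -> chart_inv (chart_to p) = p;
  chart_invK : forall x, chart_img x -> chart_to (chart_inv x) = x;
  chart_to_cont : {within chart_dom, continuous chart_to};
  chart_inv_cont : {within chart_img, continuous chart_inv} }.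

Definition overlap (c d : chart) : set 'cV[R]_n :=
  [set x | chart_img c x /\ chart_dom d (chart_inv c x)].

Definition transition (c d : chart) : 'cV[R]_n -> 'cV[R]_n :=
  chart_to d \o chart_inv c.

Definition compatible (c d : chart) : Prop :=
  smooth_on (overlap c d) (transition c d) /\
  smooth_on (overlap d c) (transition d c).

Record smooth_manifold (A : set chart) : Prop := SmoothManifold {
  manifold_hausdorff : hausdorff_space M;
  manifold_second_countable : @second_countable M;
  manifold_cover : forall p, exists2 c, A c & chart_dom c p;
  manifold_compatible : forall c d, A c -> A d -> compatible c d }.

(* The charts of the maximal atlas containing A. *)
Definition smooth_chart (A : set chart) (c : chart) : Prop :=
  forall d, A d -> compatible c d.

(* A Riemannian metric, given by its Gram matrix in every smooth chart. *)
Definition riemannian_metric (A : set chart)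
    (g : chart -> 'cV[R]_n -> 'M[R]_n) : Prop :=
  (forall c, smooth_chart A c -> riemannian_metric_on (chart_img c) (g c)) /\
  (forall c d, smooth_chart A c -> smooth_chart A d ->
     forall x, overlap c d x ->
       g c x = (jac (transition c d) x)^T *m g d (transition c d x)
                 *m jac (transition c d) x).

Definition flat (A : set chart) (g : chart -> 'cV[R]_n -> 'M[R]_n) : Prop :=
  forall c, smooth_chart A c -> flat_on (chart_img c) (g c).

Definition isometric_immersion (m : nat) (A : set chart)
    (g : chart -> 'cV[R]_n -> 'M[R]_n) (f : M -> 'cV[R]_m) : Prop :=
  forall c, smooth_chart A c ->
    isometric_immersion_on (chart_img c) (g c) (f \o chart_inv c).

Definition lagrangian (A : set chart) (f : M -> 'cV[R]_(n + n)) : Prop :=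
  forall c, smooth_chart A c -> lagrangian_on (chart_img c) (f \o chart_inv c).

End Manifolds.

(* Main.v *)
Require Import Defs.
From mathcomp Require Import all_boot all_order all_algebra.
From mathcomp Require Import all_classical all_reals all_analysis.
From mathcomp Require Import ring.

(** Write [F] for [calF].  The conditions on [Omega] give
      |f - F Omega^-1 phi|^2 = |f|^2 + 2 <Omega^-1 phi, phi - F^t f>,
    because F^t F = Omega + Omega^t; so the vectorial Ribaucour transform keeps
    the length of the position vector wherever F^t f = phi
    ([dot_ribaucour]).  The point is thus to see that, for a Lagrangian [f] in
    the unit sphere, this pointwise identity is the P^*-condition.

    Differentiating <f, f> = 1 once shows that [f] is normal to its own tangent
    spaces, hence f = J f_* X for some X since [f] is Lagrangian.
    Differentiating a second time shows that
    <alpha(Y, Z), f> = - <f_* Y, f_* Z>.  In principal coordinates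
    alpha(d_i, d_i) = J f_* d_i, so, J being an isometry, the left-hand side is
    v_i^2 X_i for Y = Z = d_i, while the right-hand side is - v_i^2.  Hence
    X_i = -1 for every i, i.e. f = - sum_i J f_* d_i
    ([spherical_lagrangian_position]).

    Finally F = f_* omega^t + J f_* omega^t P.  The first term does not
    contribute to F^t f because [f] is normal, and the second contributes
    P^t omega X = - P^t omega (sum_i d_i), which is the value that the
    P^*-condition prescribes for [phi]. *)

Set Implicit Arguments.
Unset Strict Implicit.
Unset Printing Implicit Defensive.

Import Order.TTheory GRing.Theory Num.Theory.
Import numFieldNormedType.Exports.

Local Open Scope classical_set_scope.
Local Open Scope ring_scope.

Lemma dotE (R : realType) (m : nat) (u w : 'cV[R]_m) :
  dot u w = \sum_(a < m) u a 0 * w a 0.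
Proof. by rewrite /dot mxE; apply: eq_bigr => a _; rewrite mxE. Qed.

Lemma dotC (R : realType) (m : nat) (u w : 'cV[R]_m) : dot u w = dot w u.
Proof. by rewrite !dotE; apply: eq_bigr => a _; rewrite mulrC. Qed.

Lemma dotDl (R : realType) (m : nat) (u u' w : 'cV[R]_m) :
  dot (u + u') w = dot u w + dot u' w.
Proof. by rewrite /dot linearD mulmxDl mxE. Qed.

Lemma dotNl (R : realType) (m : nat) (u w : 'cV[R]_m) : dot (- u) w = - dot u w.
Proof. by rewrite /dot linearN mulNmx mxE. Qed.

Lemma dot_mulmxl (R : realType) (m p : nat) (B : 'M[R]_(m, p)) u w :
  dot (B *m u) w = dot u (B^T *m w).
Proof. by rewrite /dot trmx_mul mulmxA. Qed.

Lemma derive_dot (R : realType) (V : normedModType R) (m : nat)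
    (F G : V -> 'cV[R]_m) (x w : V) :
  derivable F x w -> derivable G x w ->
  'D_w (fun y => dot (F y) (G y)) x = dot ('D_w F x) (G x) + dot (F x) ('D_w G x).
Proof.
move=> dF dG; have /derivable_mxP dFc := dF; have /derivable_mxP dGc := dG.
have -> : (fun y => dot (F y) (G y)) =
    \sum_(a < m) ((fun y => F y a 0) * (fun y => G y a 0)).
  by apply/funext => y; rewrite dotE fct_sumE.
rewrite derive_sum => [|a]; last exact: derivableM.
rewrite !dotE -big_split /=; apply: eq_bigr => a _.
rewrite deriveM // !derive_mx // !mxE addrC.
by rewrite [G x a 0 *: _]mulrC.
Qed.

Lemma derive_cst_on (R : realType) (V W : normedModType R) (U : set V)
    (h : V -> W) (b : W) (x w : V) :
  open U -> U x -> (forall y, U y -> h y = b) -> 'D_w h x = 0.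
Proof.
move=> oU Ux hb; rewrite (@near_eq_derive _ _ _ h (cst b)) ?derive_cst //.
have := open_nbhs_nbhs (conj oU Ux); exact: filterS.
Qed.

Lemma jac_basis_vec (R : realType) (n m : nat) (f : 'cV[R]_n -> 'cV[R]_m) x i :
  jac f x *m basis_vec R i = 'D_(basis_vec R i) f x.
Proof.
by apply/matrixP => a b; rewrite ord1 /basis_vec -colE !mxE.
Qed.

Lemma trmx_J_mul_J (R : realType) (n : nat) : (J R n)^T *m J R n = 1%:M.
Proof.
rewrite /J tr_block_mx mulmx_block !trmx0 [(- _)^T]linearN /= !trmx1.
by rewrite !(mul0mx, mulmx0, mulNmx, mulmxN, mulmx1, opprK, oppr0, add0r, addr0)
  -scalar_mx_block.
Qed.

Lemma dot_J (R : realType) (n : nat) (u w : 'cV[R]_(n + n)) :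
  dot (J R n *m u) (J R n *m w) = dot u w.
Proof. by rewrite dot_mulmxl mulmxA trmx_J_mul_J mul1mx. Qed.

Section SphericalImmersion.
Variables (R : realType) (n m : nat) (U : set 'cV[R]_n).
Variables (g : 'cV[R]_n -> 'M[R]_n) (f : 'cV[R]_n -> 'cV[R]_m).
Hypotheses (openU : open U) (smooth_f : smooth_on U f).
Hypothesis sphere_f : forall y, U y -> dot (f y) (f y) = 1.

Let derivable_f x w : U x -> derivable f x w.
Proof. by move=> Ux; apply/diff_derivable/(smooth_f [::] Ux). Qed.

Let derivable_Df x w w' : U x -> derivable ('D_w f) x w'.
Proof. by move=> Ux; apply/diff_derivable/(smooth_f [:: w] Ux). Qed.

Lemma spherical_derive_position x w : U x -> dot ('D_w f x) (f x) = 0.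
Proof.
move=> Ux; have := derive_cst_on w openU Ux sphere_f.
rewrite derive_dot; try exact: derivable_f.
by rewrite [dot (f x) _]dotC -mulr2n => /eqP; rewrite mulrn_eq0 => /eqP.
Qed.

Lemma spherical_trmx_jac_position x : U x -> (jac f x)^T *m f x = 0.
Proof.
move=> Ux; apply/matrixP => i j; rewrite ord1 mxE [RHS]mxE.
rewrite -[RHS](spherical_derive_position (basis_vec R i) Ux) dotE.
by apply: eq_bigr => a _; rewrite !mxE.
Qed.

Lemma spherical_position_normal x : U x -> normal_vector f x (f x).
Proof.
by move=> Ux X; rewrite dot_mulmxl spherical_trmx_jac_position // /dot mulmx0 mxE.
Qed.

(** The tangential correction in the Gauss formula is invisible to the normal
    vector [f x], so that only the ordinary second derivative counts; it is
    read off by differentiating [<d_j f, f> = 0] along [d_i]. *)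
Lemma spherical_sff_position x i j : U x ->
  dot (sff g f x (basis_vec R i) (basis_vec R j)) (f x) =
  - dot ('D_(basis_vec R i) f x) ('D_(basis_vec R j) f x).
Proof.
move=> Ux; rewrite /sff dotDl dotNl spherical_position_normal // subr0.
under [fun y => jac f y *m _]funext do rewrite jac_basis_vec.
have := derive_cst_on (basis_vec R i) openU Ux
  (fun y Uy => spherical_derive_position (basis_vec R j) Uy).
rewrite derive_dot; [|exact: derivable_Df|exact: derivable_f].
by move/eqP; rewrite addr_eq0 => /eqP ->; rewrite dotC.
Qed.

End SphericalImmersion.

(** With w = Omega^-1 phi, the vector F w subtracted from [f x] has squared
    length <w, (Omega + Omega^t) w> = 2 <w, phi>, and its inner product with
    [f x] is <w, phi>; the two contributions cancel, as for a reflection. *)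
Lemma dot_ribaucour (R : realType) (n m k : nat) (g : 'cV[R]_n -> 'M[R]_n)
    (f : 'cV[R]_n -> 'cV[R]_m) (phi : 'cV[R]_n -> 'cV[R]_k)
    (beta : 'cV[R]_n -> 'M[R]_(m, k)) (Omega : 'cV[R]_n -> 'M[R]_k) x :
  let F := calF g f phi beta x in
  Omega x \in unitmx -> Omega x + (Omega x)^T = F^T *m F ->
  F^T *m f x = phi x ->
  dot (ribaucour g f phi beta Omega x) (ribaucour g f phi beta Omega x) =
  dot (f x) (f x).
Proof.
move=> F Ou OF Ff; rewrite /ribaucour -/F -mulmxA.
set w := invmx (Omega x) *m phi x.
have phiE : phi x = Omega x *m w by rewrite mulmxA mulmxV // mul1mx.
have dFf : dot (F *m w) (f x) = dot w (phi x) by rewrite dot_mulmxl Ff.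
have dFF : dot (F *m w) (F *m w) = dot w (phi x) + dot (phi x) w.
  rewrite dot_mulmxl mulmxA -OF mulmxDl -phiE dotC dotDl [dot (phi x) w]dotC.
  by rewrite dot_mulmxl trmxK -phiE.
rewrite dotDl dotNl [dot (f x) _]dotC [dot (F *m w) _]dotC !dotDl !dotNl.
rewrite dFF [dot (f x) (F *m w)]dotC dFf [dot (phi x) w]dotC.
ring.
Qed.

(** The Lagrangian condition provides some X with f = J f_* X.  Its i-th
    coordinate is found by computing <alpha(d_i, d_i), f> both from
    alpha(d_i, d_i) = J f_* d_i and from [spherical_sff_position]. *)
Lemma spherical_lagrangian_position (R : realType) (n : nat)
    (U : set 'cV[R]_n) (g : 'cV[R]_n -> 'M[R]_n)
    (f : 'cV[R]_n -> 'cV[R]_(n + n)) (v : 'I_n -> 'cV[R]_n -> R) x :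
  open U -> isometric_immersion_on U g f -> lagrangian_on U f ->
  (forall y, U y -> dot (f y) (f y) = 1) -> principal_coordinates U g f v ->
  U x -> f x = J R n *m (jac f x *m const_mx (-1)).
Proof.
move=> oU [sf gE] lag sph [vpos gv sffv] Ux.
have [X fX] := (lag _ Ux (f x)).1 (spherical_position_normal oU sf sph Ux).
rewrite {1}fX; congr (_ *m (_ *m _)); apply/matrixP => i j.
rewrite ord1 [RHS]mxE.
have vi0 : v i x ^+ 2 != 0 by rewrite expf_neq0 // gt_eqF // vpos.
have dE l : dot ('D_(basis_vec R i) f x) ('D_(basis_vec R l) f x) = g x i l.
  rewrite -!jac_basis_vec dot_mulmxl mulmxA gE // /dot mulmxA.
  by rewrite /basis_vec trmx_delta -rowE -colE !mxE.
have := spherical_sff_position g oU sf sph i i Ux.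
rewrite sffv // eqxx dE gv // eqxx {1}fX dot_J dot_mulmxl mulmxA gE //.
rewrite /dot mulmxA /basis_vec trmx_delta -rowE mxE (bigD1 i) //= big1 => [|l li].
  by rewrite addr0 mxE gv // eqxx -[- (_ ^+ 2)]mulrN1 => /(mulfI vi0).
by rewrite mxE gv // eq_sym (negbTE li) mul0r.
Qed.

Lemma principal_metric_unitmx (R : realType) (n : nat)
    (U : set 'cV[R]_n) (g : 'cV[R]_n -> 'M[R]_n)
    (f : 'cV[R]_n -> 'cV[R]_(n + n)) (v : 'I_n -> 'cV[R]_n -> R) x :
  principal_coordinates U g f v -> U x -> g x \in unitmx.
Proof.
move=> [vpos gv _] Ux.
have -> : g x = diag_mx (\row_i v i x ^+ 2).
  by apply/matrixP => i j; rewrite gv // !mxE; case: eqP => [->|].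
rewrite unitmxE det_diag unitfE; apply/prodf_neq0 => i _.
by rewrite mxE expf_neq0 // gt_eqF // vpos.
Qed.

(** A tangential [f_* omega^t v] does not see the normal vector [f x], and
    [beta] turns it into [P^t omega X] when [f x = J f_* X], the metric
    cancelling against its inverse in [omega^t]. *)
Lemma trmx_calF_position (R : realType) (n k : nat)
    (g : 'cV[R]_n -> 'M[R]_n) (f : 'cV[R]_n -> 'cV[R]_(n + n))
    (phi : 'cV[R]_n -> 'cV[R]_k) (beta : 'cV[R]_n -> 'M[R]_(n + n, k))
    (P : 'M[R]_k) x X :
  (jac f x)^T *m jac f x = g x -> g x \in unitmx ->
  (jac f x)^T *m f x = 0 -> f x = J R n *m (jac f x *m X) ->
  beta x = J R n *m jac f x *m omega_t g phi x *m P ->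
  (calF g f phi beta x)^T *m f x = P^T *m omega phi x *m X.
Proof.
move=> gE gu f0 fX bE.
have gT : (g x)^T = g x by rewrite -gE trmx_mul trmxK.
rewrite /calF linearD /= mulmxDl trmx_mul -[_ *m f x]mulmxA f0 mulmx0 add0r.
rewrite bE fX /omega_t !trmx_mul trmxK trmx_inv gT !mulmxA.
rewrite -[_ *m (J R n)^T *m J R n]mulmxA trmx_J_mul_J mulmx1.
rewrite -[_ *m (jac f x)^T *m jac f x]mulmxA gE.
by rewrite mulmxKV.
Qed.

Theorem theorem53 (R : realType) (n k : nat) (M : topologicalType)
    (A : set (chart R M n)) (g : chart R M n -> 'cV[R]_n -> 'M[R]_n)
    (f : M -> 'cV[R]_(n + n)) :
  smooth_manifold A -> riemannian_metric A g -> flat A g ->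
  isometric_immersion A g f -> lagrangian A f ->
  range f `<=` unit_sphere R (n + n) ->
  forall (c : chart R M n) (v : 'I_n -> 'cV[R]_n -> R)
    (phi : 'cV[R]_n -> 'cV[R]_k) (beta : 'cV[R]_n -> 'M[R]_(n + n, k))
    (Omega : 'cV[R]_n -> 'M[R]_k) (P : 'M[R]_k),
  let fc := f \o chart_inv c in
  let ftilde := ribaucour (g c) fc phi beta Omega in
  smooth_chart A c ->
  Pstar_transform_data (chart_img c) (g c) fc phi beta Omega P v ->
  ftilde @` regular_points (chart_img c) ftilde `<=` unit_sphere R (n + n).
Proof.
move=> _ _ _ immf lagf sphf c v phi beta Omega P fc ftilde Ac.
move=> [prin [rib _ betaE _] star] _ [x [Ux _] <-].
have oU := @chart_img_open _ _ _ c.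
have sph y : chart_img c y -> dot (fc y) (fc y) = 1.
  by move=> _; apply: sphf; exists (chart_inv c y).
have [sf gE] := immf c Ac.
have fX := spherical_lagrangian_position oU (immf c Ac) (lagf c Ac) sph prin Ux.
have gu := principal_metric_unitmx prin Ux.
have f0 := spherical_trmx_jac_position oU sf sph Ux.
rewrite /unit_sphere /= /ftilde dot_ribaucour ?sph //.
- exact: ribaucour_Omega_unit rib _ Ux.
- exact: ribaucour_Omega_sym rib _ Ux.
rewrite (trmx_calF_position (gE _ Ux) gu f0 fX (betaE _ Ux)).
have -> : const_mx (-1) = - \sum_(i < n) basis_vec R i :> 'cV[R]_n.
  apply/matrixP => i j; rewrite ord1 !mxE summxE (bigD1 i) //= big1 => [|l li].
    by rewrite mxE !eqxx addr0.
  by rewrite mxE eq_sym (negbTE li).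
move/eqP: (star _ Ux); rewrite addr_eq0 => /eqP ->.
rewrite mulmxN mulmx_sumr; congr (- _); apply: eq_bigr => i _.
rewrite /gamma -scalemxAr scalerA mulfV ?scale1r ?mulmxA //.
by rewrite gt_eqF // (principal_pos prin).
Qed.
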